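(* Let $\{m_j\}_{j\in\mathbb{N}_0}$ be a strictly decreasing sequence of real numbers such that $m_j\to-\infty$ as $j\to\infty$. Suppose $\sigma_j\in M^{m_j}_{\rho,\Lambda}(\mathbb{T}\times\mathbb{Z})$ for every $j\in\mathbb{N}_0$. Then there exists a symbol $\sigma\in M^{m_0}_{\rho,\Lambda}(\mathbb{T}\times\mathbb{Z})$ such that $\sigma\sim\sum_{j=0}^\infty\sigma_j$, i.e. such that $$\sigma(x,k)-\sum_{j=0}^{N-1}\sigma_j(x,k)\in M^{m_N}_{\rho,\Lambda}(\mathbb{T}\times\mathbb{Z})$$ for every positive integer $N$.
   Context: $\mathbb{N}_0=\{0,1,2,\dots\}$, and $\mathbb{T}=\mathbb{R}/2\pi\mathbb{Z}$ is the one-dimensional torus. For a function $a$ of $k\in\mathbb{Z}$, $\Delta_k a(k)=a(k+1)-a(k)$ and $\Delta_k^\alpha$ is its $\alpha$-th iterate. Weight function: $\Lambda:\mathbb{Z}\to(0,\infty)$ is a fixed function for which there are positive constants $\mu_0\le\mu_1$, $C_0,C_1$ with $C_0(1+|k|)^{\mu_0}\le\Lambda(k)\le C_1(1+|k|)^{\mu_1}$ for all $k\in\mathbb{Z}$. Moreover there is a real constant $\mu\ge\mu_1$ such that for all $\alpha\in\mathbb{N}_0$ and $\gamma\in\{0,1\}$ there is $C_{\alpha,\gamma}>0$ with $|k^\gamma\Delta_k^{\alpha+\gamma}\Lambda(k)|\le C_{\alpha,\gamma}\Lambda(k)^{1-\alpha/\mu}$ for all $k\in\mathbb{Z}$. Fix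 $\rho\in(0,1/\mu]$. Symbol classes: for $m\in\mathbb{R}$, $S^m_{\rho,\Lambda}(\mathbb{T}\times\mathbb{Z})$ is the set of functions $\sigma:\mathbb{T}\times\mathbb{Z}\to\mathbb{C}$, smooth in $x$ for every $k\in\mathbb{Z}$, such that for all $\alpha,\beta\in\mathbb{N}_0$ there is $C_{\alpha,\beta}>0$ with $|\Delta_k^\alpha\partial_x^\beta\sigma(x,k)|\le C_{\alpha,\beta}\Lambda(k)^{m-\rho\alpha}$ for all $(x,k)\in\mathbb{T}\times\mathbb{Z}$. $M^m_{\rho,\Lambda}(\mathbb{T}\times\mathbb{Z})$ is the set of functions $\sigma:\mathbb{T}\times\mathbb{Z}\to\mathbb{C}$, smooth in $x$ for every $k$, such that $k^\gamma\Delta_k^\gamma\sigma(x,k)\in S^m_{\rho,\Lambda}(\mathbb{T}\times\mathbb{Z})$ for each $\gamma\in\{0,1\}$. *)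

(* Defs.v *)
From Stdlib Require Import Reals ZArith.
From Coquelicot Require Import Coquelicot.
Open Scope R_scope.

Definition Delta {G : AbelianGroup} (a : Z -> G) : Z -> G :=
  fun k => minus (a (k + 1)%Z) (a k).

Definition Delta_n {G : AbelianGroup} (n : nat) (a : Z -> G) : Z -> G :=
  Nat.iter n Delta a.

(* The exponents mu0, mu1, mu are parameters, the multiplicative constants are
   existential.  [Rpower] is the real power, used here on positive bases only. *)
Definition weight_function (mu0 mu1 mu : R) (Lambda : Z -> R) : Prop :=
  (forall k, 0 < Lambda k) /\
  0 < mu0 /\ mu0 <= mu1 /\ mu1 <= mu /\
  (exists C0 C1 : R, 0 < C0 /\ 0 < C1 /\
     forall k : Z,
       C0 * Rpower (1 + Rabs (IZR k)) mu0 <= Lambda k /\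
       Lambda k <= C1 * Rpower (1 + Rabs (IZR k)) mu1) /\
  (forall alpha gamma : nat, (gamma <= 1)%nat ->
     exists Cst : R, 0 < Cst /\
       forall k : Z,
         Rabs (IZR k ^ gamma * Delta_n (alpha + gamma) Lambda k)
         <= Cst * Rpower (Lambda k) (1 - INR alpha / mu)).

(* Functions on T x Z, with T = R / 2 pi Z, are functions R -> Z -> C that are
   2 pi-periodic in the first variable.  C-valued functions of a real variable
   are differentiated through their real and imaginary parts. *)
Definition periodic_in_x (sigma : R -> Z -> C) : Prop :=
  forall (x : R) (k : Z), sigma (x + 2 * PI) k = sigma x k.

Definition smooth_in_x (sigma : R -> Z -> C) : Prop :=
  forall (k : Z) (n : nat) (x : R),
    ex_derive_n (fun t => Re (sigma t k)) n x /\
    ex_derive_n (fun t => Im (sigma t k)) n x.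

Definition deriv_x (n : nat) (sigma : R -> Z -> C) : R -> Z -> C :=
  fun x k => (Derive_n (fun t => Re (sigma t k)) n x,
              Derive_n (fun t => Im (sigma t k)) n x).

Definition symbol_S (Lambda : Z -> R) (rho m : R) (sigma : R -> Z -> C) : Prop :=
  periodic_in_x sigma /\ smooth_in_x sigma /\
  forall alpha beta : nat, exists Cst : R, 0 < Cst /\
    forall (x : R) (k : Z),
      Cmod (Delta_n alpha (fun l => deriv_x beta sigma x l) k)
      <= Cst * Rpower (Lambda k) (m - rho * INR alpha).

Definition symbol_M (Lambda : Z -> R) (rho m : R) (sigma : R -> Z -> C) : Prop :=
  periodic_in_x sigma /\ smooth_in_x sigma /\
  forall gamma : nat, (gamma <= 1)%nat ->
    symbol_S Lambda rho m
      (fun x k => (RtoC (IZR k ^ gamma) * Delta_n gamma (fun l => sigma x l) k)%C).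

(* [sum_n a n] is a 0 + ... + a n, whence the index N - 1. *)
Definition asymptotic_expansion (Lambda : Z -> R) (rho : R) (m : nat -> R)
    (sigmas : nat -> R -> Z -> C) (sigma : R -> Z -> C) : Prop :=
  forall N : nat, (1 <= N)%nat ->
    symbol_M Lambda rho (m N)
      (fun x k => (sigma x k - sum_n (fun j => sigmas j x k) (N - 1))%C).

(* Main.v *)
Require Import Defs.
From Stdlib Require Import Reals ZArith.
From Stdlib Require Import Lra Lia FunctionalExtensionality ClassicalEpsilon.
From Coquelicot Require Import Coquelicot.
Open Scope R_scope.

(** The symbol is a Borel-type sum with sharp cut-offs in the frequency:
    [sigma x k] is the partial sum [sigma_0 + ... + sigma_(nu k)], where
    [nu k] tends to infinity with [|k|], but slowly.  Each [sigma . k] is then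
    a finite sum, so that smoothness and periodicity in [x] are immediate.

    Sharp cut-offs destroy the gain [- rho * alpha] of the differences near the
    jumps of [nu], but this costs nothing.  As [m j] tends to minus infinity and
    [Lambda] lies between two positive powers of [1 + |k|], the derivatives of
    [sigma_j] decay like any prescribed power of [1 + |k|] once [j] is large.
    If [nu] grows slowly enough to keep the constants of [sigma_j] below
    [1 + |k|] for all [j <= nu k] ([exists_slow_index]), the remainder
    [sigma - (sigma_0 + ... + sigma_J)] decays like a prescribed power as soon
    as [J] is large ([diagonal_remainder_decay]).  Such decay bounds every
    difference and every factor [k ^ gamma] by brute force
    ([weighted_difference_decay]), and a power of [Lambda], of either sign, is
    bounded below by a power of [1 + |k|] ([pow_Lambda_ge]).

    Hence a single estimate, with [gamma], [alpha], [beta] and [N] fixed, follows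
    by choosing [J] in terms of these numbers and splitting
    [sigma - (sigma_0 + ... + sigma_(N-1))] into [sigma_N + ... + sigma_J],
    which has order [m N], and the remainder after [J]. *)

(** * Complex functions of one real variable *)

Definition smoothC (f : R -> C) : Prop :=
  forall (n : nat) (x : R),
    ex_derive_n (fun t => Re (f t)) n x /\ ex_derive_n (fun t => Im (f t)) n x.

Definition DeriveC (n : nat) (f : R -> C) (x : R) : C :=
  (Derive_n (fun t => Re (f t)) n x, Derive_n (fun t => Im (f t)) n x).

Lemma smoothC_lin (a b : R) (f g : R -> C) :
  smoothC f -> smoothC g -> smoothC (fun t => RtoC a * f t + RtoC b * g t)%C.
Proof.
  intros Hf Hg n x.
  split.
  - apply ex_derive_n_ext with (fun t => a * Re (f t) + b * Re (g t)).
    { intros t; unfold Re; simpl; ring. }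
    apply ex_derive_n_plus; apply filter_forall; intros y k _;
      apply ex_derive_n_scal_l; [apply Hf | apply Hg].
  - apply ex_derive_n_ext with (fun t => a * Im (f t) + b * Im (g t)).
    { intros t; unfold Im; simpl; ring. }
    apply ex_derive_n_plus; apply filter_forall; intros y k _;
      apply ex_derive_n_scal_l; [apply Hf | apply Hg].
Qed.

Lemma DeriveC_lin (a b : R) (f g : R -> C) (n : nat) (x : R) :
  smoothC f -> smoothC g ->
  DeriveC n (fun t => RtoC a * f t + RtoC b * g t)%C x
  = (RtoC a * DeriveC n f x + RtoC b * DeriveC n g x)%C.
Proof.
  intros Hf Hg.
  apply injective_projections; simpl.
  - rewrite (Derive_n_ext _ (fun t => a * Re (f t) + b * Re (g t))).
    2:{ intros t; unfold Re; simpl; ring. }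
    rewrite Derive_n_plus;
      [ | apply filter_forall; intros y k _; apply ex_derive_n_scal_l; apply Hf
        | apply filter_forall; intros y k _; apply ex_derive_n_scal_l; apply Hg ].
    rewrite !Derive_n_scal_l; ring.
  - rewrite (Derive_n_ext _ (fun t => a * Im (f t) + b * Im (g t))).
    2:{ intros t; unfold Im; simpl; ring. }
    rewrite Derive_n_plus;
      [ | apply filter_forall; intros y k _; apply ex_derive_n_scal_l; apply Hf
        | apply filter_forall; intros y k _; apply ex_derive_n_scal_l; apply Hg ].
    rewrite !Derive_n_scal_l; ring.
Qed.

Lemma scal_as_lin (a : R) (f : R -> C) :
  (fun t => RtoC a * f t)%C = (fun t => RtoC a * f t + RtoC 0 * f t)%C.
Proof. apply functional_extensionality; intros t; ring. Qed.

Lemma plus_as_lin (f g : R -> C) :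
  (fun t => f t + g t)%C = (fun t => RtoC 1 * f t + RtoC 1 * g t)%C.
Proof. apply functional_extensionality; intros t; ring. Qed.

Lemma minus_as_lin (f g : R -> C) :
  (fun t => f t - g t)%C = (fun t => RtoC 1 * f t + RtoC (-1) * g t)%C.
Proof.
  apply functional_extensionality; intros t.
  apply injective_projections; simpl; ring.
Qed.

Lemma smoothC_scal (a : R) (f : R -> C) :
  smoothC f -> smoothC (fun t => RtoC a * f t)%C.
Proof. intros Hf; rewrite scal_as_lin; now apply smoothC_lin. Qed.

Lemma smoothC_plus (f g : R -> C) :
  smoothC f -> smoothC g -> smoothC (fun t => f t + g t)%C.
Proof. intros Hf Hg; rewrite plus_as_lin; now apply smoothC_lin. Qed.

Lemma smoothC_minus (f g : R -> C) :
  smoothC f -> smoothC g -> smoothC (fun t => f t - g t)%C.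
Proof. intros Hf Hg; rewrite minus_as_lin; now apply smoothC_lin. Qed.

Lemma DeriveC_scal (a : R) (f : R -> C) (n : nat) (x : R) :
  smoothC f -> DeriveC n (fun t => RtoC a * f t)%C x = (RtoC a * DeriveC n f x)%C.
Proof. intros Hf; rewrite scal_as_lin, DeriveC_lin by assumption; ring. Qed.

Lemma DeriveC_plus (f g : R -> C) (n : nat) (x : R) :
  smoothC f -> smoothC g ->
  DeriveC n (fun t => f t + g t)%C x = (DeriveC n f x + DeriveC n g x)%C.
Proof. intros Hf Hg; rewrite plus_as_lin, DeriveC_lin by assumption; ring. Qed.

Lemma DeriveC_minus (f g : R -> C) (n : nat) (x : R) :
  smoothC f -> smoothC g ->
  DeriveC n (fun t => f t - g t)%C x = (DeriveC n f x - DeriveC n g x)%C.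
Proof.
  intros Hf Hg; rewrite minus_as_lin, DeriveC_lin by assumption.
  apply injective_projections; simpl; ring.
Qed.

Lemma smoothC_sum_n (f : nat -> R -> C) (n : nat) :
  (forall j, smoothC (f j)) -> smoothC (fun t => sum_n (fun j => f j t) n).
Proof.
  intros Hf; induction n as [|n IH].
  - replace (fun t => sum_n (fun j => f j t) 0) with (f 0%nat); [apply Hf|].
    apply functional_extensionality; intros t; now rewrite sum_O.
  - replace (fun t => sum_n (fun j => f j t) (S n))
      with (fun t => sum_n (fun j => f j t) n + f (S n) t)%C.
    + now apply smoothC_plus.
    + apply functional_extensionality; intros t; now rewrite sum_Sn.
Qed.

Lemma DeriveC_sum_n (f : nat -> R -> C) (n b : nat) (x : R) :
  (forall j, smoothC (f j)) ->
  DeriveC b (fun t => sum_n (fun j => f j t) n) x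
  = sum_n (fun j => DeriveC b (f j) x) n.
Proof.
  intros Hf; induction n as [|n IH].
  - rewrite sum_O.
    replace (fun t => sum_n (fun j => f j t) 0) with (f 0%nat); [reflexivity|].
    apply functional_extensionality; intros t; now rewrite sum_O.
  - rewrite sum_Sn, <- IH.
    replace (fun t => sum_n (fun j => f j t) (S n))
      with (fun t => sum_n (fun j => f j t) n + f (S n) t)%C.
    + apply DeriveC_plus; [now apply smoothC_sum_n | apply Hf].
    + apply functional_extensionality; intros t; now rewrite sum_Sn.
Qed.

(** * Weighted differences *)

Definition weighted_difference (gamma alpha : nat) (a : Z -> C) : Z -> C :=
  Delta_n alpha (fun l => RtoC (IZR l ^ gamma) * Delta_n gamma a l)%C.

Lemma Delta_n_S (n : nat) (a : Z -> C) (k : Z) :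
  Delta_n (S n) a k = (Delta_n n a (k + 1)%Z - Delta_n n a k)%C.
Proof. reflexivity. Qed.

Lemma Delta_n_plus (n : nat) (a b : Z -> C) (k : Z) :
  Delta_n n (fun l => a l + b l)%C k = (Delta_n n a k + Delta_n n b k)%C.
Proof.
  revert k; induction n as [|n IH]; intros k; [reflexivity|].
  rewrite !Delta_n_S, !IH.
  match goal with |- @eq _ ?u ?v => change (@eq C u v) end; ring.
Qed.

Lemma weighted_difference_plus (gamma alpha : nat) (a b : Z -> C) (k : Z) :
  weighted_difference gamma alpha (fun l => a l + b l)%C k
  = (weighted_difference gamma alpha a k + weighted_difference gamma alpha b k)%C.
Proof.
  unfold weighted_difference.
  rewrite <- Delta_n_plus; f_equal.
  apply functional_extensionality; intros l; rewrite Delta_n_plus; ring.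
Qed.

Lemma smooth_Delta_n (n : nat) (sigma : R -> Z -> C) :
  smooth_in_x sigma -> smooth_in_x (fun x k => Delta_n n (fun l => sigma x l) k).
Proof.
  intros Hs; induction n as [|n IH]; [exact Hs|].
  intros k.
  exact (smoothC_minus _ _ (IH (k + 1)%Z) (IH k)).
Qed.

Lemma deriv_x_Delta_n (n b : nat) (sigma : R -> Z -> C) (x : R) (k : Z) :
  smooth_in_x sigma ->
  deriv_x b (fun y l => Delta_n n (fun l' => sigma y l') l) x k
  = Delta_n n (deriv_x b sigma x) k.
Proof.
  intros Hs; revert k; induction n as [|n IH]; intros k; [reflexivity|].
  rewrite Delta_n_S, <- !IH.
  exact (DeriveC_minus _ _ b x
           (smooth_Delta_n n sigma Hs (k + 1)%Z) (smooth_Delta_n n sigma Hs k)).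
Qed.

Lemma smooth_weighted (gamma : nat) (sigma : R -> Z -> C) :
  smooth_in_x sigma ->
  smooth_in_x
    (fun x k => RtoC (IZR k ^ gamma) * Delta_n gamma (fun l => sigma x l) k)%C.
Proof.
  intros Hs k; exact (smoothC_scal _ _ (smooth_Delta_n gamma sigma Hs k)).
Qed.

Lemma deriv_x_weighted (gamma b : nat) (sigma : R -> Z -> C) (x : R) (k : Z) :
  smooth_in_x sigma ->
  deriv_x b
    (fun y l => RtoC (IZR l ^ gamma) * Delta_n gamma (fun l' => sigma y l') l)%C x k
  = (RtoC (IZR k ^ gamma) * Delta_n gamma (deriv_x b sigma x) k)%C.
Proof.
  intros Hs; rewrite <- deriv_x_Delta_n by assumption.
  exact (DeriveC_scal _ _ b x (smooth_Delta_n gamma sigma Hs k)).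
Qed.

Lemma deriv_x_minus (b : nat) (sigma tau : R -> Z -> C) (x : R) (k : Z) :
  smooth_in_x sigma -> smooth_in_x tau ->
  deriv_x b (fun y l => sigma y l - tau y l)%C x k
  = (deriv_x b sigma x k - deriv_x b tau x k)%C.
Proof. intros Hs Ht; exact (DeriveC_minus _ _ b x (Hs k) (Ht k)). Qed.

Definition weighted_bound (Lambda : Z -> R) (s : R) (gamma alpha : nat)
    (F : R -> Z -> C) : Prop :=
  exists Cst : R, 0 < Cst /\
    forall x k, Cmod (weighted_difference gamma alpha (F x) k)
                <= Cst * Rpower (Lambda k) s.

(** Since [x]-derivatives commute with [k ^ gamma * Delta ^ gamma], membership
    in the class splits into independent bounds, each on a linear operator
    applied to one [x]-derivative.  The asymptotic sum needs this: the index at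
    which it is cut in two depends on [gamma], [alpha] and [beta]. *)
Lemma symbol_M_iff (Lambda : Z -> R) (rho m : R) (sigma : R -> Z -> C) :
  symbol_M Lambda rho m sigma <->
  periodic_in_x sigma /\ smooth_in_x sigma /\
  forall gamma alpha beta : nat, (gamma <= 1)%nat ->
    weighted_bound Lambda (m - rho * INR alpha) gamma alpha (deriv_x beta sigma).
Proof.
  assert (Heq : smooth_in_x sigma -> forall gamma alpha beta x k,
    Delta_n alpha
      (fun l => deriv_x beta
         (fun y l0 => RtoC (IZR l0 ^ gamma)
                      * Delta_n gamma (fun l' => sigma y l') l0)%C x l) k
    = weighted_difference gamma alpha (deriv_x beta sigma x) k).
  { intros Hs gamma alpha beta x k; unfold weighted_difference; f_equal.
    apply functional_extensionality; intros l; now apply deriv_x_weighted. }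
  split.
  - intros (Hp & Hs & H); split; [exact Hp|]; split; [exact Hs|].
    intros gamma alpha beta Hg.
    destruct (H gamma Hg) as (_ & _ & HS).
    destruct (HS alpha beta) as (Cst & HC & HB).
    exists Cst; split; [exact HC|].
    intros x k; rewrite <- Heq by exact Hs; apply HB.
  - intros (Hp & Hs & H); split; [exact Hp|]; split; [exact Hs|].
    intros gamma Hg; split; [|split].
    + intros x k; do 2 f_equal.
      apply functional_extensionality; intros l; apply Hp.
    + now apply smooth_weighted.
    + intros alpha beta.
      destruct (H gamma alpha beta Hg) as (Cst & HC & HB).
      exists Cst; split; [exact HC|].
      intros x k; rewrite Heq by exact Hs; apply HB.
Qed.

Lemma weighted_bound_plus (Lambda : Z -> R) (s : R) (gamma alpha : nat)
    (F G : R -> Z -> C) :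
  weighted_bound Lambda s gamma alpha F -> weighted_bound Lambda s gamma alpha G ->
  weighted_bound Lambda s gamma alpha (fun x k => F x k + G x k)%C.
Proof.
  intros (A & HA & HF) (B & HB & HG).
  exists (A + B); split; [lra|].
  intros x k; rewrite weighted_difference_plus.
  eapply Rle_trans; [apply Cmod_triangle|].
  specialize (HF x k); specialize (HG x k); lra.
Qed.

Lemma symbol_M_plus (Lambda : Z -> R) (rho m : R) (sigma tau : R -> Z -> C) :
  symbol_M Lambda rho m sigma -> symbol_M Lambda rho m tau ->
  symbol_M Lambda rho m (fun x k => sigma x k + tau x k)%C.
Proof.
  rewrite !symbol_M_iff; intros (Hp & Hs & H) (Hp' & Hs' & H').
  split; [intros x k; now rewrite Hp, Hp'|].
  split; [intros k; exact (smoothC_plus _ _ (Hs k) (Hs' k))|].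
  intros gamma alpha beta Hg.
  replace (deriv_x beta (fun x k => sigma x k + tau x k)%C)
    with (fun x k => deriv_x beta sigma x k + deriv_x beta tau x k)%C.
  - apply weighted_bound_plus; auto.
  - apply functional_extensionality; intros x.
    apply functional_extensionality; intros k.
    symmetry; exact (DeriveC_plus _ _ beta x (Hs k) (Hs' k)).
Qed.

(** * Powers of the weight against powers of [1 + |k|] *)

Definition bracket (k : Z) : R := 1 + Rabs (IZR k).

Lemma bracket_ge_1 (k : Z) : 1 <= bracket k.
Proof. unfold bracket; generalize (Rabs_pos (IZR k)); lra. Qed.

Lemma bracket_le_shift (k : Z) : bracket k <= 2 * bracket (k + 1).
Proof.
  unfold bracket; rewrite plus_IZR.
  generalize (Rabs_triang (IZR k + 1) (-1)).
  replace (IZR k + 1 + -1) with (IZR k) by ring.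
  rewrite (Rabs_left (-1)) by lra.
  generalize (Rabs_pos (IZR k + 1)); lra.
Qed.

Lemma pow_bracket_pos (k : Z) (p : nat) : 0 < bracket k ^ p.
Proof. apply pow_lt; generalize (bracket_ge_1 k); lra. Qed.

Lemma pow_bracket_exp (k : Z) (p : nat) :
  bracket k ^ p = exp (INR p * ln (bracket k)).
Proof.
  rewrite <- Rpower_pow; [reflexivity|]; generalize (bracket_ge_1 k); lra.
Qed.

Lemma ln_bracket_ge_0 (k : Z) : 0 <= ln (bracket k).
Proof. rewrite <- ln_1; apply ln_le; generalize (bracket_ge_1 k); lra. Qed.

Definition log_comparable (mu0 mu1 c0 c1 : R) (Lambda : Z -> R) : Prop :=
  forall k, c0 + mu0 * ln (bracket k) <= ln (Lambda k) <= c1 + mu1 * ln (bracket k).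

Lemma weight_function_log (mu0 mu1 mu : R) (Lambda : Z -> R) :
  weight_function mu0 mu1 mu Lambda ->
  exists c0 c1, log_comparable mu0 mu1 c0 c1 Lambda.
Proof.
  intros (HL & _ & _ & _ & (C0 & C1 & H0 & H1 & H) & _).
  exists (ln C0), (ln C1); intros k.
  destruct (H k) as [Ha Hb].
  fold (bracket k) in Ha, Hb.
  assert (Hl : forall c e, 0 < c -> ln (c * Rpower (bracket k) e)
                                    = ln c + e * ln (bracket k)).
  { intros c e Hc; unfold Rpower; rewrite ln_mult, ln_exp;
      [reflexivity | exact Hc | apply exp_pos]. }
  split.
  - rewrite <- Hl by exact H0; apply ln_le; [|exact Ha].
    apply Rmult_lt_0_compat; [exact H0 | apply exp_pos].
  - rewrite <- Hl by exact H1; now apply ln_le.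
Qed.

Lemma exp_le_mono (x y : R) : x <= y -> exp x <= exp y.
Proof. intros [H| ->]; [left; now apply exp_increasing | right; reflexivity]. Qed.

Section Comparison.

Variables (mu0 mu1 c0 c1 : R) (Lambda : Z -> R).
Hypothesis mu0_pos : 0 < mu0.
Hypothesis mu1_pos : 0 < mu1.
Hypothesis Hlog : log_comparable mu0 mu1 c0 c1 Lambda.

Lemma Rpower_Lambda_mono (s t : R) : s <= t ->
  forall k, Rpower (Lambda k) s <= exp ((s - t) * c0) * Rpower (Lambda k) t.
Proof.
  intros Hst k; unfold Rpower; rewrite <- exp_plus; apply exp_le_mono.
  generalize (ln_bracket_ge_0 k); intros Hb.
  destruct (Hlog k) as [Ha _].
  assert (0 <= mu0 * ln (bracket k)) by (apply Rmult_le_pos; lra).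
  nra.
Qed.

(** The constant does not depend on the power [p]: the slow index is
    chosen from these constants before [p] is known. *)
Lemma pow_Lambda_le (s : R) (p : nat) : INR p <= - mu0 * s ->
  forall k, bracket k ^ p * Rpower (Lambda k) s <= exp (s * c0).
Proof.
  intros Hp k; rewrite pow_bracket_exp; unfold Rpower; rewrite <- exp_plus.
  apply exp_le_mono.
  generalize (ln_bracket_ge_0 k) (pos_INR p); intros Hb Hp0.
  destruct (Hlog k) as [Ha _].
  assert (Hs : s <= 0) by nra.
  assert (s * ln (Lambda k) <= s * (c0 + mu0 * ln (bracket k))) by nra.
  assert (INR p * ln (bracket k) <= - mu0 * s * ln (bracket k))
    by (apply Rmult_le_compat_r; lra).
  lra.
Qed.

Lemma pow_Lambda_ge (s : R) :
  exists (p : nat) (c : R), 0 < c /\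
    forall k, 1 <= c * (bracket k ^ p * Rpower (Lambda k) s).
Proof.
  destruct (nfloor_ex (Rabs s * mu1)) as [p [_ Hp]].
  { apply Rmult_le_pos; [apply Rabs_pos | lra]. }
  exists (S p), (exp (Rabs s * (Rabs c0 + Rabs c1))); split; [apply exp_pos|].
  intros k; rewrite pow_bracket_exp; unfold Rpower; rewrite <- !exp_plus.
  rewrite <- exp_0 at 1; apply exp_le_mono.
  rewrite S_INR.
  generalize (ln_bracket_ge_0 k); intros Hb.
  destruct (Hlog k) as [Ha Hc].
  assert (Hab : Rabs (ln (Lambda k)) <= Rabs c0 + Rabs c1 + mu1 * ln (bracket k)).
  { assert (0 <= mu0 * ln (bracket k)) by (apply Rmult_le_pos; lra).
    assert (0 <= mu1 * ln (bracket k)) by (apply Rmult_le_pos; lra).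
    generalize (Rle_abs c1) (Rle_abs (- c0)) (Rabs_pos c0) (Rabs_pos c1).
    rewrite Rabs_Ropp; intros.
    apply Rabs_le; lra. }
  assert (Hsl : - (s * ln (Lambda k)) <= Rabs s * Rabs (ln (Lambda k))).
  { rewrite <- Rabs_mult, <- Rabs_Ropp; apply Rle_abs. }
  assert (Rabs s * Rabs (ln (Lambda k))
          <= Rabs s * (Rabs c0 + Rabs c1 + mu1 * ln (bracket k)))
    by (apply Rmult_le_compat_l; [apply Rabs_pos | exact Hab]).
  assert (Rabs s * mu1 * ln (bracket k) <= (INR p + 1) * ln (bracket k))
    by (apply Rmult_le_compat_r; lra).
  lra.
Qed.

Lemma symbol_M_mono (rho s t : R) (sigma : R -> Z -> C) : s <= t ->
  symbol_M Lambda rho s sigma -> symbol_M Lambda rho t sigma.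
Proof.
  intros Hst; rewrite !symbol_M_iff; intros (Hp & Hs & H).
  split; [exact Hp|]; split; [exact Hs|].
  intros gamma alpha beta Hg.
  destruct (H gamma alpha beta Hg) as (A & HA & HB).
  exists (A * exp ((s - t) * c0)); split.
  { apply Rmult_lt_0_compat; [exact HA | apply exp_pos]. }
  intros x k; eapply Rle_trans; [apply HB|].
  rewrite Rmult_assoc; apply Rmult_le_compat_l; [lra|].
  eapply Rle_trans.
  - apply (Rpower_Lambda_mono _ (t - rho * INR alpha)); lra.
  - right; do 2 f_equal; ring.
Qed.

End Comparison.

(** * Decaying sequences *)

Lemma Delta_decay (p : nat) (M : R) (a : Z -> C) :
  (forall k, bracket k ^ p * Cmod (a k) <= M) ->
  forall k, bracket k ^ p * Cmod (Defs.Delta a k) <= (2 ^ p + 1) * M.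
Proof.
  intros Ha k.
  change (Defs.Delta a k) with (a (k + 1)%Z + - a k)%C.
  assert (Ht := Cmod_triangle (a (k + 1)%Z) (- a k)%C).
  rewrite Cmod_opp in Ht.
  assert (Hb : bracket k ^ p <= 2 ^ p * bracket (k + 1) ^ p).
  { rewrite <- Rpow_mult_distr; apply pow_incr.
    generalize (bracket_ge_1 k) (bracket_le_shift k); lra. }
  assert (H1 := Ha (k + 1)%Z); assert (H2 := Ha k).
  assert (Hpos := pow_bracket_pos k p).
  assert (Hc := Cmod_ge_0 (a (k + 1)%Z)).
  assert (H2p : 0 < 2 ^ p) by (apply pow_lt; lra).
  apply Rle_trans with
    (bracket k ^ p * Cmod (a (k + 1)%Z) + bracket k ^ p * Cmod (a k)).
  { rewrite <- Rmult_plus_distr_l; apply Rmult_le_compat_l; lra. }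
  assert (bracket k ^ p * Cmod (a (k + 1)%Z)
          <= 2 ^ p * bracket (k + 1) ^ p * Cmod (a (k + 1)%Z))
    by (apply Rmult_le_compat_r; lra).
  assert (2 ^ p * (bracket (k + 1) ^ p * Cmod (a (k + 1)%Z)) <= 2 ^ p * M)
    by (apply Rmult_le_compat_l; lra).
  lra.
Qed.

Lemma Delta_n_decay (n p : nat) (M : R) (a : Z -> C) :
  (forall k, bracket k ^ p * Cmod (a k) <= M) ->
  forall k, bracket k ^ p * Cmod (Delta_n n a k) <= (2 ^ p + 1) ^ n * M.
Proof.
  intros Ha; induction n as [|n IH]; intros k.
  - change (Delta_n 0 a k) with (a k); simpl; rewrite Rmult_1_l; apply Ha.
  - change (Delta_n (S n) a) with (Defs.Delta (Delta_n n a)).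
    simpl; rewrite Rmult_assoc; now apply Delta_decay.
Qed.

(** Differences are estimated by the triangle inequality alone: for decaying
    sequences there is no cancellation to be exploited, and the factor
    [k ^ gamma] only costs [gamma] powers of decay. *)
Lemma weighted_difference_decay (gamma alpha p : nat) (M : R) (a : Z -> C) :
  (forall k, bracket k ^ (p + gamma) * Cmod (a k) <= M) ->
  forall k, bracket k ^ p * Cmod (weighted_difference gamma alpha a k)
            <= (2 ^ p + 1) ^ alpha * ((2 ^ (p + gamma) + 1) ^ gamma * M).
Proof.
  intros Ha; unfold weighted_difference; apply Delta_n_decay; intros k.
  eapply Rle_trans; [|apply (Delta_n_decay gamma _ _ _ Ha k)].
  rewrite Cmod_mult, Cmod_R, pow_add, <- RPow_abs, Rmult_assoc.
  apply Rmult_le_compat_l; [left; apply pow_bracket_pos|].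
  apply Rmult_le_compat_r; [apply Cmod_ge_0|].
  apply pow_incr; split; [apply Rabs_pos|unfold bracket; lra].
Qed.

(** * The slow index *)

Lemma exists_greatest_below (Q : nat -> R) (t : R) (b : nat) :
  exists n, (n <= b)%nat /\ (n = 0%nat \/ Q n <= t) /\
    forall J, (J <= b)%nat -> Q J <= t -> (J <= n)%nat.
Proof.
  induction b as [|b (n & Hn & HQ & HJ)].
  - exists 0%nat; repeat split; auto.
  - destruct (Rle_dec (Q (S b)) t) as [H|H].
    + exists (S b); repeat split; auto.
    + exists n; repeat split; [lia | exact HQ |].
      intros J HJb HJt; apply HJ; [|exact HJt].
      destruct (Nat.eq_dec J (S b)) as [->|]; [contradiction | lia].
Qed.

Lemma term_le_sum_f_R0 (f : nat -> R) (n j : nat) :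
  (forall i, 0 <= f i) -> (j <= n)%nat -> f j <= sum_f_R0 f n.
Proof.
  intros Hf; induction n as [|n IH]; intros Hj; simpl.
  - replace j with 0%nat by lia; lra.
  - destruct (Nat.eq_dec j (S n)) as [->|Hne].
    + generalize (cond_pos_sum f n Hf); lra.
    + assert (H := IH ltac:(lia)); generalize (Hf (S n)); lra.
Qed.

(** A diagonal argument: [nu] grows so slowly that at frequency [k] the
    constants of the terms [j <= nu k] are at most [bracket k].  Only the
    derivatives of order [beta <= j] are controlled for the [j]-th term, hence
    every order is controlled for all but finitely many [j]. *)
Lemma exists_slow_index (B : nat -> nat -> R) :
  exists nu : Z -> nat,
    (forall k, INR (nu k) <= bracket k) /\
    (forall k j beta, (1 <= j <= nu k)%nat -> (beta <= j)%nat ->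
       B j beta <= bracket k) /\
    (forall J : nat, exists K : R, forall k, K <= bracket k -> (J <= nu k)%nat).
Proof.
  set (Q := sum_f_R0 (fun j => sum_f_R0 (fun beta => Rabs (B j beta)) j)).
  assert (HabsB : forall j i, 0 <= Rabs (B j i)) by (intros; apply Rabs_pos).
  assert (HQ : forall n j beta, (j <= n)%nat -> (beta <= j)%nat -> B j beta <= Q n).
  { intros n j beta Hj Hb.
    apply Rle_trans with (Rabs (B j beta)); [apply Rle_abs|].
    eapply Rle_trans;
      [exact (term_le_sum_f_R0 (fun i => Rabs (B j i)) j beta (HabsB j) Hb)|].
    apply (term_le_sum_f_R0 (fun j => sum_f_R0 (fun i => Rabs (B j i)) j));
      [|exact Hj].
    intros i; now apply cond_pos_sum. }
  set (P := fun k n => (n <= Z.abs_nat k)%nat /\ (n = 0%nat \/ Q n <= bracket k) /\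
    forall J, (J <= Z.abs_nat k)%nat -> Q J <= bracket k -> (J <= n)%nat).
  assert (HP : forall k, exists n, P k n)
    by (intros k; apply exists_greatest_below).
  assert (Habs : forall k, INR (Z.abs_nat k) = Rabs (IZR k)).
  { intros k; rewrite INR_IZR_INZ, Zabs2Nat.id_abs; apply abs_IZR. }
  assert (Hnu : exists nu, forall k, P k (nu k)).
  { exists (fun k => proj1_sig (constructive_indefinite_description _ (HP k))).
    intros k; apply proj2_sig. }
  destruct Hnu as [nu Hnu]; exists nu; split; [|split].
  - intros k; destruct (Hnu k) as (Hn & _).
    apply le_INR in Hn; rewrite Habs in Hn; unfold bracket; lra.
  - intros k j beta Hj Hb; destruct (Hnu k) as (_ & [H0|HQn] & _); [lia|].
    eapply Rle_trans; [apply (HQ (nu k) j beta); [lia | exact Hb] | exact HQn].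
  - intros J; exists (Rmax (1 + INR J) (Q J)); intros k HK.
    destruct (Hnu k) as (_ & _ & Hmax); apply Hmax.
    + apply INR_le; rewrite Habs.
      generalize (Rmax_l (1 + INR J) (Q J)); unfold bracket in HK; lra.
    + generalize (Rmax_r (1 + INR J) (Q J)); lra.
Qed.

(** * The diagonal partial sum and its remainders *)

Lemma Cmod_sum_n_sub (f : nat -> C) (M : R) (i n : nat) : (i <= n)%nat ->
  (forall j, (i < j <= n)%nat -> Cmod (f j) <= M) ->
  Cmod (sum_n f n - sum_n f i)%C <= INR (n - i) * M.
Proof.
  intros Hin; induction Hin as [|n Hin IH]; intros HM.
  - replace (sum_n f i - sum_n f i)%C with (RtoC 0) by ring.
    rewrite Cmod_0, Nat.sub_diag; simpl; lra.
  - rewrite sum_Sn.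
    replace (plus (sum_n f n) (f (S n)) - sum_n f i)%C
      with ((sum_n f n - sum_n f i) + f (S n))%C
      by (change (plus (sum_n f n) (f (S n))) with (sum_n f n + f (S n))%C; ring).
    eapply Rle_trans; [apply Cmod_triangle|].
    replace (S n - i)%nat with (S (n - i)) by lia.
    rewrite S_INR.
    assert (H1 := IH ltac:(intros; apply HM; lia)).
    assert (H2 := HM (S n) ltac:(lia)); lra.
Qed.

Definition diagonal_sum (nu : Z -> nat) (sigmas : nat -> R -> Z -> C) :
    R -> Z -> C :=
  fun x k => sum_n (fun j => sigmas j x k) (nu k).

Lemma smooth_diagonal_sum (nu : Z -> nat) (sigmas : nat -> R -> Z -> C) :
  (forall j, smooth_in_x (sigmas j)) -> smooth_in_x (diagonal_sum nu sigmas).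
Proof.
  intros Hs k.
  exact (smoothC_sum_n (fun j t => sigmas j t k) (nu k) (fun j => Hs j k)).
Qed.

Lemma periodic_diagonal_sum (nu : Z -> nat) (sigmas : nat -> R -> Z -> C) :
  (forall j, periodic_in_x (sigmas j)) -> periodic_in_x (diagonal_sum nu sigmas).
Proof. intros Hp x k; apply sum_n_ext; intros j; apply Hp. Qed.

Lemma deriv_x_diagonal_sum (nu : Z -> nat) (sigmas : nat -> R -> Z -> C)
    (b : nat) (x : R) (k : Z) :
  (forall j, smooth_in_x (sigmas j)) ->
  deriv_x b (diagonal_sum nu sigmas) x k
  = sum_n (fun j => deriv_x b (sigmas j) x k) (nu k).
Proof.
  intros Hs.
  exact (DeriveC_sum_n (fun j t => sigmas j t k) (nu k) b x (fun j => Hs j k)).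
Qed.

(** Each term beyond [J] decays like [p + 2] powers with constant [B]; one power of [bracket k]
    absorbs that constant, the other one the number of terms, which is at most
    [nu k].  Where [nu k < J] the frequencies are bounded, and
    local boundedness of the terms is enough. *)
Lemma diagonal_remainder_decay (nu : Z -> nat) (B : nat -> nat -> R)
    (sigmas : nat -> R -> Z -> C) (J beta p : nat) :
  (forall k, INR (nu k) <= bracket k) ->
  (forall k j b, (1 <= j <= nu k)%nat -> (b <= j)%nat -> B j b <= bracket k) ->
  (exists K, forall k, K <= bracket k -> (J <= nu k)%nat) ->
  (forall j, smooth_in_x (sigmas j)) ->
  (beta <= J)%nat ->
  (forall j x k, (J < j)%nat ->
     bracket k ^ (p + 2) * Cmod (deriv_x beta (sigmas j) x k) <= B j beta) ->
  (forall j (K : R), exists D, forall x k, bracket k <= K ->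
     Cmod (deriv_x beta (sigmas j) x k) <= D) ->
  exists M, forall x k,
    bracket k ^ p
    * Cmod (deriv_x beta (fun y l => diagonal_sum nu sigmas y l
                           - sum_n (fun j => sigmas j y l) J)%C x k) <= M.
Proof.
  intros Hnu HB [K HK] Hs HbJ Hdec Hloc.
  assert (Hder : forall x k,
    deriv_x beta (fun y l => diagonal_sum nu sigmas y l
                             - sum_n (fun j => sigmas j y l) J)%C x k
    = (sum_n (fun j => deriv_x beta (sigmas j) x k) (nu k)
       - sum_n (fun j => deriv_x beta (sigmas j) x k) J)%C).
  { intros x k.
    rewrite <- (deriv_x_diagonal_sum nu) by exact Hs.
    rewrite <- (deriv_x_diagonal_sum (fun _ => J)) by exact Hs.
    apply deriv_x_minus; [now apply smooth_diagonal_sum|].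
    exact (smooth_diagonal_sum (fun _ => J) sigmas Hs). }
  assert (HD : forall n, exists D, 0 <= D /\ forall j x k, (j <= n)%nat -> bracket k <= K ->
            Cmod (deriv_x beta (sigmas j) x k) <= D).
  { induction n as [|n (D & HD0 & HD)].
    - destruct (Hloc 0%nat K) as [D HD]; exists (Rmax 0 D); split; [apply Rmax_l|].
      intros j x k Hj Hk; replace j with 0%nat by lia.
      eapply Rle_trans; [now apply HD | apply Rmax_r].
    - destruct (Hloc (S n) K) as [D' HD']; exists (Rmax D D'); split.
      { eapply Rle_trans; [exact HD0 | apply Rmax_l]. }
      intros j x k Hj Hk; destruct (Nat.eq_dec j (S n)) as [->|Hne].
      + eapply Rle_trans; [now apply HD' | apply Rmax_r].
      + eapply Rle_trans; [apply HD; [lia | exact Hk] | apply Rmax_l]. }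
  destruct (HD J) as (D & HD0 & HDJ); clear HD.
  exists (Rmax 1 (Rabs K ^ p * (INR J * D))).
  intros x k; rewrite Hder.
  assert (Hbr := bracket_ge_1 k).
  destruct (le_lt_dec J (nu k)) as [HJ|HJ].
  - eapply Rle_trans; [|apply Rmax_l].
    assert (Hpos := pow_bracket_pos k (p + 1)).
    assert (Hterm : forall j, (J < j <= nu k)%nat ->
      Cmod (deriv_x beta (sigmas j) x k) <= / bracket k ^ (p + 1)).
    { intros j Hj.
      apply (Rmult_le_reg_l (bracket k ^ (p + 1))); [exact Hpos|].
      rewrite Rinv_r by lra.
      apply (Rmult_le_reg_r (bracket k)); [lra|].
      rewrite Rmult_1_l.
      eapply Rle_trans; [|apply (HB k j beta); lia].
      eapply Rle_trans; [|apply (Hdec j x k); lia].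
      right; replace (p + 2)%nat with (p + 1 + 1)%nat by lia.
      rewrite (pow_add _ (p + 1) 1); simpl; ring. }
    assert (H := Cmod_sum_n_sub _ _ J (nu k) HJ Hterm).
    assert (Hn : INR (nu k - J) <= bracket k).
    { eapply Rle_trans; [apply le_INR | apply Hnu]; lia. }
    apply Rle_trans with (bracket k ^ p * (bracket k * / bracket k ^ (p + 1))).
    + apply Rmult_le_compat_l; [left; apply pow_bracket_pos|].
      eapply Rle_trans; [exact H|].
      apply Rmult_le_compat_r; [|exact Hn].
      left; now apply Rinv_0_lt_compat.
    + right; rewrite pow_add; simpl; field.
      split; [lra | apply pow_nonzero; lra].
  - eapply Rle_trans; [|apply Rmax_r].
    assert (HkK : bracket k <= K).
    { destruct (Rle_lt_dec K (bracket k)) as [Hle|]; [|lra].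
      specialize (HK k Hle); lia. }
    rewrite <- Cmod_opp, Copp_minus_distr.
    apply Rmult_le_compat;
      [left; apply pow_bracket_pos | apply Cmod_ge_0 | |].
    + apply pow_incr; split; [lra|].
      eapply Rle_trans; [exact HkK | apply Rle_abs].
    + eapply Rle_trans;
        [apply (Cmod_sum_n_sub _ D (nu k) J); [lia|]; intros j Hj; apply HDJ; [lia|exact HkK]|].
      apply Rmult_le_compat_r; [exact HD0|]; apply le_INR; lia.
Qed.

(** * Asymptotic summation *)

Lemma m_antitone (m : nat -> R) : (forall j, m (S j) < m j) ->
  forall i j, (i <= j)%nat -> m j <= m i.
Proof.
  intros Hm i j Hij; induction Hij as [|j Hij IH]; [lra|].
  specialize (Hm j); lra.
Qed.

Lemma symbol_M_partial_sum_sub (mu0 mu1 c0 c1 : R) (Lambda : Z -> R) (rho : R)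
    (m : nat -> R) (sigmas : nat -> R -> Z -> C) (i n : nat) :
  0 < mu0 -> log_comparable mu0 mu1 c0 c1 Lambda ->
  (forall j, m (S j) < m j) ->
  (forall j, symbol_M Lambda rho (m j) (sigmas j)) ->
  (i < n)%nat ->
  symbol_M Lambda rho (m (S i))
    (fun x k => sum_n (fun j => sigmas j x k) n - sum_n (fun j => sigmas j x k) i)%C.
Proof.
  intros Hmu0 Hlog Hm HM Hin; induction Hin as [|n Hin IH].
  - replace (fun x k => sum_n (fun j => sigmas j x k) (S i)
                        - sum_n (fun j => sigmas j x k) i)%C with (sigmas (S i)).
    { apply HM. }
    apply functional_extensionality; intros x.
    apply functional_extensionality; intros k.
    rewrite sum_Sn.
    change (plus ?u ?v) with (u + v)%C; ring.
  - replace (fun x k => sum_n (fun j => sigmas j x k) (S n)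
                        - sum_n (fun j => sigmas j x k) i)%C
      with (fun x k => (sum_n (fun j => sigmas j x k) n
                        - sum_n (fun j => sigmas j x k) i) + sigmas (S n) x k)%C.
    + apply symbol_M_plus; [exact IH|].
      apply (symbol_M_mono mu0 mu1 c0 c1 Lambda Hmu0 Hlog) with (m (S n)); [|apply HM].
      apply m_antitone; [exact Hm | lia].
    + apply functional_extensionality; intros x.
      apply functional_extensionality; intros k.
      rewrite sum_Sn.
      change (plus ?u ?v) with (u + v)%C; ring.
Qed.

Lemma symbol_M_derivative_bound (Lambda : Z -> R) (rho m : R) (sigma : R -> Z -> C)
    (beta : nat) :
  symbol_M Lambda rho m sigma ->
  exists A, 0 < A /\
    forall x k, Cmod (deriv_x beta sigma x k) <= A * Rpower (Lambda k) m.
Proof.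
  rewrite symbol_M_iff; intros (_ & _ & H).
  destruct (H 0%nat 0%nat beta ltac:(lia)) as (A & HA & HB).
  exists A; split; [exact HA|]; intros x k.
  specialize (HB x k).
  change (weighted_difference 0 0 (deriv_x beta sigma x) k)
    with (RtoC 1 * deriv_x beta sigma x k)%C in HB.
  rewrite Cmult_1_l in HB.
  replace (m - rho * INR 0) with m in HB by (simpl; ring).
  exact HB.
Qed.

Lemma symbol_M_locally_bounded (mu0 mu1 c0 c1 : R) (Lambda : Z -> R)
    (rho m : R) (sigma : R -> Z -> C) (beta : nat) (K : R) :
  0 < mu0 -> 0 < mu1 -> log_comparable mu0 mu1 c0 c1 Lambda ->
  symbol_M Lambda rho m sigma ->
  exists D, forall x k, bracket k <= K -> Cmod (deriv_x beta sigma x k) <= D.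
Proof.
  intros Hmu0 Hmu1 Hlog HM.
  destruct (symbol_M_derivative_bound _ _ _ _ beta HM) as (A & HA0 & HA).
  (* A lower bound for [Lambda ^ (- m)] is an upper bound for [Lambda ^ m]. *)
  destruct (pow_Lambda_ge mu0 mu1 c0 c1 Lambda Hmu0 Hmu1 Hlog (- m))
    as (q & c & Hc & Hq).
  exists (A * (c * Rabs K ^ q)); intros x k Hk.
  eapply Rle_trans; [apply HA|].
  apply Rmult_le_compat_l; [lra|].
  specialize (Hq k); rewrite Rpower_Ropp in Hq.
  assert (HR : 0 < Rpower (Lambda k) m) by apply exp_pos.
  apply Rle_trans with (c * bracket k ^ q).
  - apply (Rmult_le_compat_r (Rpower (Lambda k) m)) in Hq; [|lra].
    rewrite Rmult_1_l in Hq; eapply Rle_trans; [exact Hq|].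
    right; field; lra.
  - apply Rmult_le_compat_l; [lra|].
    apply pow_incr; generalize (bracket_ge_1 k) (Rle_abs K); lra.
Qed.

Theorem theorem3p1
  (Lambda : Z -> R) (mu0 mu1 mu rho : R)
  (hLambda : weight_function mu0 mu1 mu Lambda)
  (hrho0 : 0 < rho) (hrho1 : rho <= 1 / mu)
  (m : nat -> R)
  (hdecr : forall j : nat, m (S j) < m j)
  (hlim : is_lim_seq m m_infty)
  (sigmas : nat -> R -> Z -> C)
  (hsigmas : forall j : nat, symbol_M Lambda rho (m j) (sigmas j)) :
  exists sigma : R -> Z -> C,
    symbol_M Lambda rho (m 0%nat) sigma /\
    asymptotic_expansion Lambda rho m sigmas sigma.
Proof.
  destruct (weight_function_log _ _ _ _ hLambda) as (c0 & c1 & Hlog).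
  destruct hLambda as (_ & Hmu0 & Hmu01 & _).
  assert (Hmu1 : 0 < mu1) by lra.
  assert (Hp : forall j, periodic_in_x (sigmas j)) by (intros j; exact (proj1 (hsigmas j))).
  assert (Hs : forall j, smooth_in_x (sigmas j))
    by (intros j; exact (proj1 (proj2 (hsigmas j)))).
  assert (HA : forall j beta, exists A, 0 < A /\ forall x k,
    Cmod (deriv_x beta (sigmas j) x k) <= A * Rpower (Lambda k) (m j)).
  { intros j beta; eapply symbol_M_derivative_bound; apply hsigmas. }
  assert (HA' : exists A : nat -> nat -> R, forall j beta, 0 < A j beta /\ forall x k,
    Cmod (deriv_x beta (sigmas j) x k) <= A j beta * Rpower (Lambda k) (m j)).
  { exists (fun j beta =>
      proj1_sig (constructive_indefinite_description _ (HA j beta))).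
    intros j beta; exact (proj2_sig (constructive_indefinite_description _ (HA j beta))). }
  destruct HA' as [A HA']; clear HA.
  destruct (exists_slow_index (fun j beta => A j beta * exp (m j * c0)))
    as (nu & Hnu & HB & HK).
  set (sigma := diagonal_sum nu sigmas).
  assert (Hloc : forall beta j (K : R), exists D, forall x k, bracket k <= K ->
     Cmod (deriv_x beta (sigmas j) x k) <= D).
  { intros beta j K.
    apply (symbol_M_locally_bounded mu0 mu1 c0 c1 Lambda rho (m j)); auto. }
  assert (Hexp : asymptotic_expansion Lambda rho m sigmas sigma).
  { intros N HN; rewrite symbol_M_iff.
    assert (Hs1 : smooth_in_x sigma) by now apply smooth_diagonal_sum.
    assert (Hs2 : forall n, smooth_in_x (fun x k => sum_n (fun j => sigmas j x k) n)).
    { intros n; exact (smooth_diagonal_sum (fun _ => n) sigmas Hs). }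
    split; [|split].
    - intros x k.
      apply (f_equal2 Cminus); [exact (periodic_diagonal_sum nu sigmas Hp x k)|].
      exact (periodic_diagonal_sum (fun _ => (N - 1)%nat) sigmas Hp x k).
    - intros k; exact (smoothC_minus _ _ (Hs1 k) (Hs2 (N - 1)%nat k)).
    - intros gamma alpha beta Hg.
      destruct (pow_Lambda_ge mu0 mu1 c0 c1 Lambda Hmu0 Hmu1 Hlog
                  (m N - rho * INR alpha)) as (p & c & Hc & Hpc).
      (* Beyond [J0] the order [m j] yields decay of order [p + gamma + 2]: [gamma]
         for the weight in front of the difference, 2 for the remainder lemma.
         Adding [beta] makes the slow index control derivatives of order [beta]. *)
      destruct (proj2 (is_lim_seq_spec _ _) hlim (- (INR (p + gamma + 2) / mu0)))
        as [J0 HJ0].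
      set (J := (J0 + beta + N)%nat).
      destruct (diagonal_remainder_decay nu (fun j b => A j b * exp (m j * c0))
                  sigmas J beta (p + gamma) Hnu HB (HK J) Hs ltac:(unfold J; lia))
        as [M HM]; [ | exact (Hloc beta) | ].
      { intros j x k Hj.
        destruct (HA' j beta) as [HA0 HAb].
        apply Rle_trans with
          (A j beta * (bracket k ^ (p + gamma + 2) * Rpower (Lambda k) (m j))).
        - replace (A j beta * (bracket k ^ (p + gamma + 2) * Rpower (Lambda k) (m j)))
            with (bracket k ^ (p + gamma + 2) * (A j beta * Rpower (Lambda k) (m j)))
            by ring.
          apply Rmult_le_compat_l; [left; apply pow_bracket_pos | apply HAb].
        - apply Rmult_le_compat_l; [lra|].
          apply (pow_Lambda_le mu0 mu1 c0 c1 Lambda Hmu0 Hlog).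
          assert (Hj0 := HJ0 j ltac:(unfold J in Hj; lia)).
          apply (Rmult_lt_compat_l mu0) in Hj0; [|exact Hmu0].
          replace (mu0 * - (INR (p + gamma + 2) / mu0))
            with (- INR (p + gamma + 2)) in Hj0 by (field; lra).
          lra. }
      replace (deriv_x beta (fun x k => sigma x k
                               - sum_n (fun j => sigmas j x k) (N - 1))%C)
        with (fun x k =>
          deriv_x beta (fun y l => sum_n (fun j => sigmas j y l) J
                                   - sum_n (fun j => sigmas j y l) (N - 1))%C x k
          + deriv_x beta (fun y l => sigma y l - sum_n (fun j => sigmas j y l) J)%C x k)%C.
      + apply weighted_bound_plus.
        * assert (HMid : symbol_M Lambda rho (m (S (N - 1))) (fun x k =>
             sum_n (fun j => sigmas j x k) J - sum_n (fun j => sigmas j x k) (N - 1))%C).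
          { apply (symbol_M_partial_sum_sub mu0 mu1 c0 c1); auto; unfold J; lia. }
          replace (S (N - 1)) with N in HMid by lia.
          rewrite symbol_M_iff in HMid; now apply HMid.
        * set (M' := (2 ^ p + 1) ^ alpha * ((2 ^ (p + gamma) + 1) ^ gamma * M)).
          assert (HM' : forall x k, _ <= M') by
            (intros x; exact (weighted_difference_decay gamma alpha p M _ (HM x))).
          exists (c * Rmax 1 M'); split.
          { apply Rmult_lt_0_compat; [exact Hc|].
            generalize (Rmax_l 1 M'); lra. }
          intros x k; specialize (HM' x k); specialize (Hpc k).
          set (w := Cmod _) in HM' |- *.
          set (L := Rpower _ _) in Hpc |- *.
          assert (HL0 : 0 < L) by apply exp_pos.
          assert (Hw : 0 <= w) by apply Cmod_ge_0.
          apply Rle_trans with (c * L * (bracket k ^ p * w)).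
          { apply (Rmult_le_compat_r w) in Hpc; [|exact Hw].
            lra. }
          replace (c * Rmax 1 M' * L) with (c * L * Rmax 1 M') by ring.
          apply Rmult_le_compat_l; [apply Rmult_le_pos; lra|].
          eapply Rle_trans; [exact HM' | apply Rmax_r].
      + apply functional_extensionality; intros x.
        apply functional_extensionality; intros k.
        rewrite !deriv_x_minus by auto; ring. }
  exists sigma; split; [|exact Hexp].
  replace sigma with
    (fun x k => (sigma x k - sum_n (fun j => sigmas j x k) (1 - 1)) + sigmas 0%nat x k)%C.
  - apply symbol_M_plus; [|apply hsigmas].
    apply (symbol_M_mono mu0 mu1 c0 c1 Lambda Hmu0 Hlog) with (m 1%nat).
    + generalize (hdecr 0%nat); lra.
    + apply Hexp; lia.
  - apply functional_extensionality; intros x.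
    apply functional_extensionality; intros k.
    simpl; rewrite sum_O; ring.
Qed.
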